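(* For every $n \in \mathbb{N}$, the monoid $UT_n(\mathbb{Z}_{\max})$ is finitely presented by the monoid presentation $\langle \Sigma_n \mid R_n \rangle$.
   Context: $\mathbb{N}$ is the set of positive integers. $\mathbb{Z}_{\max} = \mathbb{Z}\cup\{-\infty\}$ is the tropical integer semiring, with semiring addition $\max$ and semiring multiplication the usual addition (zero $-\infty$, one $0$). $UT_n(\mathbb{Z}_{\max})$ is the monoid, under (tropical) matrix multiplication, of $n\times n$ matrices over $\mathbb{Z}_{\max}$ with all entries below the diagonal equal to $-\infty$. For an alphabet $\Sigma$, $\Sigma^*$ is the free monoid on $\Sigma$, with empty word $\varepsilon$. For $R\subseteq \Sigma^*\times\Sigma^*$, a monoid $\mathcal{S}$ is presented by $\langle \Sigma\mid R\rangle$ if $\mathcal{S}\cong\Sigma^*/\rho_R$, where $\rho_R$ is the smallest congruence on $\Sigma^*$ containing $R$; it is finitely presented by $\langle \Sigma\mid R\rangle$ if moreover $\Sigma$ and $R$ are finite. A pair $(u,v)\in R$ is written $u=v$. $\Sigma_n = \{a_k, b, c_k, d_{ij} : 1\le k\le n,\ 1\le i<j\le n\}$ is an alphabet. $R_n$ is the set of all the following relations, where $1\le i<j\le n$, $1\le k,l\le n$, and also $1 \le s<t\le n$ in (C8) and $1 \le t\le n$ in (C9): (C1) $a_ia_j=a_ja_i$; (C2) $c_ic_j=c_jc_i$; (C3) $c_k^2=c_k$; (C4) $d_{ij}^2=d_{ij}$; (C5) $a_lc_k=c_ka_l$; (C6) $a_kd_{ij}=d_{ij}a_k$ for $k\ne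 i,j$; (C7) $c_kd_{ij}=d_{ij}c_k$ for $k\neq i,j$; (C8) $d_{ij}d_{st}=d_{st}d_{ij}$ for $j\ne s<t\ne i$; (C9) $d_{ij}d_{jt}=d_{jt}d_{ij}d_{it}$ for $j<t$; (C10) $d_{ij}a_id_{ij}=a_id_{ij}$; (C11) $d_{ij}a_jd_{ij}=d_{ij}a_j$; (Z1) $a_kc_k=c_k$; (Z2) $c_id_{ij}=c_i$; (Z3) $d_{ij}c_j=c_j$; (R1) $a_kb=ba_k$; (R2) $d_{ij}b=bd_{ij}$; (R3) $a_1\cdots a_nb=\varepsilon$. *)

(* Defs.v *)
From HB Require Import structures.
From mathcomp Require Import all_boot all_order all_algebra.
From mathcomp Require Import boolp classical_sets cardinality.

Set Implicit Arguments.
Unset Strict Implicit.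
Unset Printing Implicit Defensive.

Import Order.TTheory GRing.Theory Num.Theory.

(* [None] is -oo, the zero of the semiring; [Some x] is the integer x, and the
   semiring one is [Some 0]. *)
Definition Zmax : Type := option int.

Module ZmaxSemiring.

Definition add (x y : Zmax) : Zmax :=
  match x, y with
  | Some m, Some n => Some (Order.max m n)
  | None, _ => y
  | _, None => x
  end.

Definition mul (x y : Zmax) : Zmax :=
  match x, y with
  | Some m, Some n => Some (m + n)%R
  | _, _ => None
  end.

Lemma addA : associative add.
Proof. by move=> [x|] [y|] [z|] //=; rewrite maxA. Qed.

Lemma addC : commutative add.
Proof. by move=> [x|] [y|] //=; rewrite maxC. Qed.

Lemma add0 : left_id (None : Zmax) add.
Proof. by case. Qed.

Lemma mulA : associative mul.
Proof. by move=> [x|] [y|] [z|] //=; rewrite addrA. Qed.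

Lemma mulC : commutative mul.
Proof. by move=> [x|] [y|] //=; rewrite addrC. Qed.

Lemma mul1 : left_id (Some 0%R : Zmax) mul.
Proof. by move=> [x|] //=; rewrite add0r. Qed.

Lemma mulDl : left_distributive mul add.
Proof. by move=> [x|] [y|] [z|] //=; rewrite addr_maxl. Qed.

Lemma mul0 : left_zero (None : Zmax) mul.
Proof. by case. Qed.

End ZmaxSemiring.

HB.instance Definition _ := Choice.copy Zmax (option int).
HB.instance Definition _ := GRing.isNmodule.Build Zmax
  ZmaxSemiring.addA ZmaxSemiring.addC ZmaxSemiring.add0.
HB.instance Definition _ := GRing.Nmodule_isComNzSemiRing.Build Zmax
  ZmaxSemiring.mulA ZmaxSemiring.mulC ZmaxSemiring.mul1 ZmaxSemiring.mulDl
  ZmaxSemiring.mul0 isT.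

(* [is_trig_mx] means lower triangular, hence the transpose. *)
Record UT (n : nat) (S : pzSemiRingType) := MkUT {
  UTval :> 'M[S]_n;
  UTvalP : is_trig_mx (UTval^T)%R
}.

HB.instance Definition _ n S := [isSub for @UTval n S].
HB.instance Definition _ n S := [Choice of UT n S by <:].

Section UTMonoid.
Variables (n : nat) (S : pzSemiRingType).
Local Open Scope ring_scope.

Lemma UT_one_subproof : is_trig_mx ((1%:M : 'M[S]_n)^T).
Proof. by rewrite trmx1 scalar_mx_is_trig. Qed.

Lemma UT_mul_subproof (A B : UT n S) : is_trig_mx ((A *m B)^T).
Proof.
apply/is_trig_mxP => i j ij; rewrite !mxE big1 // => k _.
have /is_trig_mxP hA := UTvalP A; have /is_trig_mxP hB := UTvalP B.
case: (leqP j k) => [jk|kj].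
  by have := hB i k (leq_trans ij jk); rewrite mxE => ->; rewrite mulr0.
by have := hA k j kj; rewrite mxE => ->; rewrite mul0r.
Qed.

Definition UT_one : UT n S := MkUT UT_one_subproof.
Definition UT_mul (A B : UT n S) : UT n S := MkUT (UT_mul_subproof A B).

Lemma UT_mulA : associative UT_mul.
Proof. by move=> A B C; apply: val_inj; rewrite /= mulmxA. Qed.

Lemma UT_mul1 : left_id UT_one UT_mul.
Proof. by move=> A; apply: val_inj; rewrite /= mul1mx. Qed.

Lemma UT_1mul : right_id UT_one UT_mul.
Proof. by move=> A; apply: val_inj; rewrite /= mulmx1. Qed.

HB.instance Definition _ := isMonoid.Build (UT n S) UT_mulA UT_mul1 UT_1mul.

End UTMonoid.

Section Presentation.
Local Open Scope classical_set_scope.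
Local Open Scope quotient_scope.
Variable Sigma : choiceType.

(* The free monoid on Sigma is [seq Sigma] with concatenation. *)
Definition congruence (E : set (seq Sigma * seq Sigma)) : Prop :=
  [/\ forall u, E (u, u),
      forall u v, E (u, v) -> E (v, u),
      forall u v w, E (u, v) -> E (v, w) -> E (u, w)
    & forall u v u' v', E (u, v) -> E (u', v') -> E (u ++ u', v ++ v')].

Variable R : set (seq Sigma * seq Sigma).

Definition rho : set (seq Sigma * seq Sigma) := smallest congruence R.

Lemma rho_congruence : congruence rho.
Proof.
split.
- by move=> u E [[rE _ _ _] _]; apply: rE.
- by move=> u v uv E ER; have [[_ sE _ _] _] := ER; apply: sE; apply: uv.
- move=> u v w uv vw E ER; have [[_ _ tE _] _] := ER.
  by apply: (tE u v w); [apply: uv | apply: vw].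
- move=> u v u' v' uv uv' E ER; have [[_ _ _ cE] _] := ER.
  by apply: cE; [apply: uv | apply: uv'].
Qed.

Definition rhob (u v : seq Sigma) : bool := `[< rho (u, v) >].

Lemma rhob_refl : reflexive rhob.
Proof. by move=> u; apply/asboolP; have [r _ _ _] := rho_congruence; apply: r. Qed.

Lemma rhob_sym : symmetric rhob.
Proof.
have [_ s _ _] := rho_congruence.
by move=> u v; apply/asboolP/asboolP; apply: s.
Qed.

Lemma rhob_trans : transitive rhob.
Proof.
have [_ _ t _] := rho_congruence.
by move=> v u w /asboolP uv /asboolP vw; apply/asboolP; apply: t uv vw.
Qed.

Canonical rho_equiv := EquivRel rhob rhob_refl rhob_sym rhob_trans.

Definition presented_monoid : Type := {eq_quot rho_equiv}.

HB.instance Definition _ := Choice.on presented_monoid.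
HB.instance Definition _ := EqQuotient.on presented_monoid.

Definition pres_one : presented_monoid := \pi_presented_monoid [::].
Definition pres_mul (x y : presented_monoid) : presented_monoid :=
  \pi_presented_monoid (repr x ++ repr y).

Lemma pres_mul_pi (u v : seq Sigma) :
  pres_mul (\pi_presented_monoid u) (\pi_presented_monoid v)
  = \pi_presented_monoid (u ++ v).
Proof.
have [_ _ _ c] := rho_congruence.
have reprP w : rho (repr (\pi_presented_monoid w), w).
  by have /eqmodP/asboolP := reprK (\pi_presented_monoid w).
by apply/eqmodP/asboolP; apply: c; apply: reprP.
Qed.

Lemma pres_mulA : associative pres_mul.
Proof.
move=> x y z; rewrite -[x]reprK -[y]reprK -[z]reprK.
by rewrite !pres_mul_pi catA !reprK.
Qed.

Lemma pres_mul1 : left_id pres_one pres_mul.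
Proof. by move=> x; rewrite -[x]reprK pres_mul_pi. Qed.

Lemma pres_1mul : right_id pres_one pres_mul.
Proof. by move=> x; rewrite -[x]reprK pres_mul_pi cats0. Qed.

HB.instance Definition _ :=
  isMonoid.Build presented_monoid pres_mulA pres_mul1 pres_1mul.

Definition presented_by (S : monoidType) : Prop :=
  exists f : presented_monoid -> S, monoid.monoid_morphism f /\ bijective f.

Definition finitely_presented_by (S : monoidType) : Prop :=
  [/\ finite_set [set: Sigma], finite_set R & presented_by S].

End Presentation.

Inductive letter (n : nat) : Type :=
  | La of 'I_n
  | Lb
  | Lc of 'I_n
  | Ld (i j : 'I_n) of i < j.

Arguments Lb {n}.

Section LetterFinite.
Variable n : nat.

Let code_type : finType :=
  ('I_n + unit + 'I_n + {p : 'I_n * 'I_n | p.1 < p.2})%type.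

Definition letter_code (x : letter n) : code_type :=
  match x with
  | La k => inl (inl (inl k))
  | Lb => inl (inl (inr tt))
  | Lc k => inl (inr k)
  | Ld i j ij => inr (exist _ (i, j) ij)
  end.

Definition letter_decode (y : code_type) : letter n :=
  match y with
  | inl (inl (inl k)) => La k
  | inl (inl (inr _)) => Lb
  | inl (inr k) => Lc k
  | inr (exist p ij) => Ld ij
  end.

Lemma letter_codeK : cancel letter_code letter_decode.
Proof. by case. Qed.

HB.instance Definition _ := Finite.copy (letter n) (can_type letter_codeK).

End LetterFinite.

Section Relations.
Variable n : nat.
Implicit Types i j k l s t : 'I_n.

Inductive relations : seq (letter n) * seq (letter n) -> Prop :=
  | rel_C1 i j : i < j -> relations ([:: La i; La j], [:: La j; La i])
  | rel_C2 i j : i < j -> relations ([:: Lc i; Lc j], [:: Lc j; Lc i])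
  | rel_C3 k : relations ([:: Lc k; Lc k], [:: Lc k])
  | rel_C4 i j (ij : i < j) : relations ([:: Ld ij; Ld ij], [:: Ld ij])
  | rel_C5 k l : relations ([:: La l; Lc k], [:: Lc k; La l])
  | rel_C6 i j k (ij : i < j) : k != i -> k != j ->
      relations ([:: La k; Ld ij], [:: Ld ij; La k])
  | rel_C7 i j k (ij : i < j) : k != i -> k != j ->
      relations ([:: Lc k; Ld ij], [:: Ld ij; Lc k])
  | rel_C8 i j s t (ij : i < j) (st : s < t) : j != s -> t != i ->
      relations ([:: Ld ij; Ld st], [:: Ld st; Ld ij])
  | rel_C9 i j t (ij : i < j) (jt : j < t) (it : i < t) :
      relations ([:: Ld ij; Ld jt], [:: Ld jt; Ld ij; Ld it])
  | rel_C10 i j (ij : i < j) :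
      relations ([:: Ld ij; La i; Ld ij], [:: La i; Ld ij])
  | rel_C11 i j (ij : i < j) :
      relations ([:: Ld ij; La j; Ld ij], [:: Ld ij; La j])
  | rel_Z1 k : relations ([:: La k; Lc k], [:: Lc k])
  | rel_Z2 i j (ij : i < j) : relations ([:: Lc i; Ld ij], [:: Lc i])
  | rel_Z3 i j (ij : i < j) : relations ([:: Ld ij; Lc j], [:: Lc j])
  | rel_R1 k : relations ([:: La k; Lb], [:: Lb; La k])
  | rel_R2 i j (ij : i < j) : relations ([:: Ld ij; Lb], [:: Lb; Ld ij])
  | rel_R3 : relations ([seq La k | k <- enum 'I_n] ++ [:: Lb], [::]).

End Relations.

(* Main.v *)
Require Import Defs.
From mathcomp Require Import all_boot all_order all_algebra.
From mathcomp Require Import boolp classical_sets cardinality.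

(** Over any semiring the upper triangular matrices are products of the
    matrices [D i x], the identity with [x] as [i]-th diagonal entry, and
    [E i j x], the identity with the extra entry [x] at [(i, j)], [i < j].
    These satisfy the evident relations collected in
    [elementary_relations]; none of them mentions an opposite or an
    inverse.

    These relations already present the monoid.  A matrix [M] is the product,
    over the rows [i] from the last to the first, of the words
    [prod_(j > i) E i j (M i j) * D i (M i i)].  In any monoid with elements
    [D] and [E] subject to the relations, multiplying this normal word on the
    left by some [D k x] or [E k l x] gives the normal word of the product
    matrix: the factor commutes with the words of the other rows until it
    meets row [k], which absorbs it, except that [E k l x], on crossing row [l],
    turns into the elements [E k j (x * M l j)] with [j >= l], which add [x]
    times row [l] to row [k] ([D_normal_word], [E_normal_word]).  Only left
    multiplication is needed: by induction on its length, a word in these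
    elements equals the normal word of the matrix that it denotes.

    For the tropical integers put [a_k = D k 1], [c_k = D k -oo],
    [d_ij = E i j 0] and let [b] be the scalar matrix [-1].  The letters
    satisfy the given relations because of the elementary ones
    ([letter_of_elementary_relations]).  Conversely, in a monoid where the
    letters satisfy the given relations, the [a_k] are commuting units, since
    [b] inverts their product; so, for an integer [x], [D k x] can be defined
    as a power of [a_k], and [E i j x] as the conjugate of [d_ij] by the [x]-th
    power of [a_i], while [E i j -oo] is the identity.  The elementary relations
    with parameters then follow from those between letters by conjugation with
    powers of the [a_k] ([elementary_relations_tropical]); the additivity
    [E i j x * E i j y = E i j (max x y)] comes from [rel_C4], [rel_C10] and
    [rel_C11].  The evaluation of words as matrices therefore has the normal
    word as a left inverse, and it is onto because all [D] and [E] are values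
    of words. *)

Set Implicit Arguments.
Unset Strict Implicit.
Unset Printing Implicit Defensive.

Import GRing.Theory Num.Theory Order.TTheory.
Local Open Scope group_scope.

(** * Elementary relations and normal words *)

(** As [er_DE] and [er_ED] hold for every scalar [x], they include, for [x = 0],
    that [D i 0] absorbs [E i j y] on its right and that [D j 0] absorbs it on
    its left.  [er_EE] is the commutator relation of elementary matrices,
    written without inverses. *)
Record elementary_relations (n : nat) (S : pzSemiRingType) (P : monoidType)
    (D : 'I_n -> S -> P) (E : 'I_n -> 'I_n -> S -> P) : Prop :=
  ElementaryRelations {
  er_D1 i : D i 1%R = 1;
  er_DM i x y : D i x * D i y = D i (x * y)%R;
  er_E0 (i j : 'I_n) : (i < j)%N -> E i j 0%R = 1;
  er_EA (i j : 'I_n) x y : (i < j)%N -> E i j x * E i j y = E i j (x + y)%R;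
  er_DC i j x y : i != j -> commute (D i x) (D j y);
  er_DEC (k i j : 'I_n) x y : (i < j)%N -> k != i -> k != j ->
    commute (D k x) (E i j y);
  er_DE (i j : 'I_n) x y : (i < j)%N ->
    D i x * E i j y = E i j (x * y)%R * D i x;
  er_ED (i j : 'I_n) x y : (i < j)%N ->
    E i j y * D j x = D j x * E i j (y * x)%R;
  er_EC (i j s t : 'I_n) x y : (i < j)%N -> (s < t)%N -> j != s -> t != i ->
    commute (E i j x) (E s t y);
  er_EE (i j t : 'I_n) x y : (i < j)%N -> (j < t)%N ->
    E i j x * E j t y = E j t y * E i j x * E i t (x * y)%R }.

Section NormalForm.
Variables (n : nat) (S : pzSemiRingType) (P : monoidType).
Variables (D : 'I_n -> S -> P) (E : 'I_n -> 'I_n -> S -> P).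
Implicit Types (i j k l : 'I_n) (x y : S) (r : 'I_n -> S) (M : 'I_n -> 'I_n -> S).

Definition row_offdiag i r : P := \prod_(j < n | (i < j)%N) E i j (r j).
(** For matrices, this is the identity with its [i]-th row replaced by [r].
    The diagonal factor comes last, so that the same formula serves when
    [r i] is not invertible. *)
Definition row_word i r : P := row_offdiag i r * D i (r i).

Definition descending (s : seq 'I_n) := pairwise (fun i j : 'I_n => (j < i)%N) s.

Lemma descending_rev_enum : descending (rev (enum 'I_n)).
Proof.
rewrite /descending -sorted_pairwise => [|j i k ji kj]; last exact: ltn_trans kj ji.
rewrite rev_sorted -[sorted _ _](@sorted_map _ _ val ltn).
by rewrite val_enum_ord iota_ltn_sorted.
Qed.

(** The rows are inserted from the first to the last, hence the first row is
    the rightmost factor: the word of row [i] combines the rows [j >= i] of what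
    stands on its right, and those must still be rows of the identity. *)
Definition normal_word M : P := \prod_(i <- rev (enum 'I_n)) row_word i (M i).

Lemma row_word_eq i r r' : (forall j, (i <= j)%N -> r j = r' j) ->
  row_word i r = row_word i r'.
Proof.
move=> rr'; congr (_ * D i _); last exact: rr'.
by apply: eq_bigr => j /ltnW/rr' ->.
Qed.

Lemma normal_word_eq M M' : (forall i j, (i <= j)%N -> M i j = M' i j) ->
  normal_word M = normal_word M'.
Proof. by move=> MM'; apply: eq_bigr => i _; apply: row_word_eq => j /MM'. Qed.

Hypothesis DE : elementary_relations D E.

Lemma normal_word1 : normal_word (fun i j => (i == j)%:R%R) = 1.
Proof.
apply: big1_seq => i _; rewrite /row_word eqxx (er_D1 DE) mulg1.
by apply: big1 => j ij; rewrite -val_eqE ltn_eqF // (er_E0 DE).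
Qed.

Lemma commute_row_offdiag i r z :
  (forall j, (i < j)%N -> commute z (E i j (r j))) -> commute z (row_offdiag i r).
Proof. exact: commute_prod. Qed.

Lemma commute_row_word i r z :
    commute z (D i (r i)) -> (forall j, (i < j)%N -> commute z (E i j (r j))) ->
  commute z (row_word i r).
Proof. by move=> zD zE; apply: commuteM => //; apply: commute_row_offdiag. Qed.

Lemma D_row_word k x r : D k x * row_word k r = row_word k (fun j => x * r j)%R.
Proof.
rewrite /row_word mulgA /row_offdiag.
suff -> : D k x * \prod_(j < n | (k < j)%N) E k j (r j)
    = \prod_(j < n | (k < j)%N) E k j (x * r j)%R * D k x.
  by rewrite -mulgA (er_DM DE).
apply: (big_rec2 (fun a b => D k x * b = a * D k x)).
  by rewrite mulg1 mul1g.
by move=> j a b kj IH; rewrite mulgA (er_DE DE) // -!mulgA IH.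
Qed.

Lemma E_row_word k r r' : row_offdiag k r' * row_word k r
  = row_word k (fun j => r j + (if (k < j)%N then r' j else 0))%R.
Proof.
rewrite /row_word ltnn addr0 mulgA -prodgM_commute => [|i j ki kj].
  by congr (_ * _); apply: eq_bigr => j kj; rewrite (er_EA DE) // addrC kj.
by apply: (er_EC DE); rewrite // -val_eqE gtn_eqF.
Qed.

Lemma D_row_word_commute k i x r : (k < i)%N ->
  commute (D k x) (row_word i r).
Proof.
move=> ki; apply: commute_row_word => [|j ij].
  by apply: (er_DC DE); rewrite -val_eqE ltn_eqF.
by apply: (er_DEC DE); rewrite // -val_eqE ltn_eqF // (ltn_trans ki ij).
Qed.

Lemma E_row_word_commute k l i x r : (k < l)%N -> (k < i)%N -> i != l ->
  commute (E k l x) (row_word i r).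
Proof.
move=> kl ki il; apply: commute_row_word => [|j ij].
  by apply/commute_sym/(er_DEC DE); rewrite // -val_eqE gtn_eqF.
apply: (er_EC DE); rewrite // 1?eq_sym //.
by rewrite -val_eqE ltn_eqF // (ltn_trans ki ij).
Qed.

(** The factor [E k i (r' i)] is the only one that fails to commute with row
    [i]. *)
Lemma row_offdiag_commute k r' i r : (k < i)%N -> r' i = 0%R ->
  commute (row_offdiag k r') (row_word i r).
Proof.
move=> ki r'i; apply/commute_sym/commute_row_offdiag => j kj.
have [->|ij] := eqVneq j i; first by rewrite r'i (er_E0 DE) //; apply: commute1.
by apply/commute_sym/E_row_word_commute; rewrite // eq_sym.
Qed.

(** Each factor [E l j (r j)] that [E k l x] crosses produces [E k j (x * r j)]
    by [er_EE]; what is produced commutes with all the factors of row [l]. *)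
Lemma E_row_offdiag k l x r : (k < l)%N ->
  E k l x * row_offdiag l r
  = row_offdiag l r * (E k l x * \prod_(j < n | (l < j)%N) E k j (x * r j)%R).
Proof.
move=> kl; rewrite /row_offdiag.
have EE (s : seq 'I_n) j : (l < j)%N -> forall y,
    commute (E k j y) (\prod_(i <- s | (l < i)%N) E l i (r i)).
  move=> lj y; apply: commute_prod => i li.
  apply: (er_EC DE); rewrite ?(ltn_trans kl) //; first by rewrite -val_eqE gtn_eqF.
  by rewrite -val_eqE gtn_eqF // (ltn_trans kl).
have EV (s : seq 'I_n) j : (l < j)%N -> forall y,
    commute (E k j y) (\prod_(i <- s | (l < i)%N) E k i (x * r i)%R).
  move=> lj y; apply: commute_prod => i li.
  by apply: (er_EC DE); rewrite ?(ltn_trans kl) // -val_eqE gtn_eqF // (ltn_trans kl).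
elim: (index_enum _) => [|j s IH]; first by rewrite !big_nil !mul1g.
rewrite !big_cons; case: ifP => // lj.
rewrite mulgA (er_EE DE) // -!mulgA; congr (_ * _).
by rewrite EE // mulgA IH -!mulgA; congr (_ * (_ * _)); rewrite EV.
Qed.

(** The entry in column [l] becomes [x * r l] by [er_ED], when [E k l x] crosses
    the diagonal factor of row [l]: this is how [x] times row [l] travels on
    towards row [k]. *)
Lemma E_row_word_pass k l x r : (k < l)%N ->
  E k l x * row_word l r
  = row_word l r * row_offdiag k (fun j => if (l <= j)%N then x * r j else 0)%R.
Proof.
move=> kl; rewrite /row_word mulgA E_row_offdiag // -!mulgA; congr (_ * _).
set V := \prod_(j < n | _) _.
have -> : V * D l (r l) = D l (r l) * V.
  apply/commute_sym/commute_prod => j lj.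
  apply: (er_DEC DE); first exact: ltn_trans lj.
    by rewrite -val_eqE gtn_eqF.
  by rewrite -val_eqE ltn_eqF.
rewrite mulgA (er_ED DE) // -mulgA; congr (_ * _).
(* Both factors become products over all columns [j > k], padded with
   [E k j 0 = 1], so that they can be multiplied columnwise. *)
have -> : E k l (x * r l)%R
    = \prod_(j < n | (k < j)%N) E k j (if j == l then x * r j else 0)%R.
  transitivity (\prod_(j < n | j == l) E k j (x * r j)%R).
    by rewrite big_pred1_eq.
  rewrite big_mkcond [RHS]big_mkcond.
  apply: eq_bigr => j _; have [->|jl] := eqVneq j l; first by rewrite kl.
  by case: ifP => // /(er_E0 DE).
have -> : V = \prod_(j < n | (k < j)%N) E k j (if (l < j)%N then x * r j else 0)%R.
  rewrite /V big_mkcond [RHS]big_mkcond; apply: eq_bigr => j _.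
  case: (ltnP l j) => [lj|jl]; first by rewrite (ltn_trans kl lj).
  by case: ifP => // /(er_E0 DE).
rewrite -prodgM_commute => [|i j ki kj].
  apply: eq_bigr => j kj; rewrite (er_EA DE) //; congr (E k j _).
  have [->|jl] := eqVneq j l; first by rewrite leqnn ltnn addr0.
  by rewrite add0r [(l < j)%N]ltn_neqAle val_eqE eq_sym jl.
by apply: (er_EC DE); rewrite // -val_eqE gtn_eqF.
Qed.

(** The induction is on the list of rows, for any descending list that contains
    [k]; the rows met before [k] have larger indices. *)
Lemma D_normal_word k x M : D k x * normal_word M
  = normal_word (fun i j => if i == k then x * M k j else M i j)%R.
Proof.
rewrite /normal_word; set s := rev _.
have : k \in s by rewrite mem_rev mem_enum.
have : descending s := descending_rev_enum.
elim: s => //= i s IH /andP[/allP si ds]; rewrite inE !big_cons /=.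
have [eq_ki _|ki /= ks] := eqVneq k i.
  subst i; rewrite mulgA D_row_word; congr (_ * _).
  by apply: eq_big_seq => j /si jk; rewrite -val_eqE ltn_eqF.
by rewrite mulgA (D_row_word_commute _ _ (si _ ks)) -mulgA IH.
Qed.

Lemma row_offdiag_descending k r' M s :
    descending s -> k \in s -> (forall i, i \in s -> (k < i)%N -> r' i = 0%R) ->
  row_offdiag k r' * \prod_(i <- s) row_word i (M i)
  = \prod_(i <- s) row_word i (fun j => if i == k
      then M k j + (if (k < j)%N then r' j else 0) else M i j)%R.
Proof.
elim: s => //= i s IH /andP[/allP si ds]; rewrite inE !big_cons /= => ks r'0.
have [eq_ki|ki] := eqVneq k i.
  subst i; rewrite mulgA E_row_word; congr (_ * _).
  by apply: eq_big_seq => j /si jk; rewrite -val_eqE ltn_eqF.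
move: ks; rewrite (negbTE ki) /= => ks.
rewrite mulgA row_offdiag_commute ?si // ?r'0 ?si ?mem_head // -mulgA IH //.
by move=> j js; apply: r'0; rewrite inE js orbT.
Qed.

(** Row [l] comes before row [k] in the word as [k < l]; between the two, the
    elements [E k j _] with [j >= l] meet rows [i < l] only. *)
Lemma E_normal_word k l x M : (k < l)%N -> E k l x * normal_word M
  = normal_word (fun i j => if i == k
      then M k j + (if (l <= j)%N then x * M l j else 0) else M i j)%R.
Proof.
move=> kl; rewrite /normal_word; set s := rev _.
have : k \in s by rewrite mem_rev mem_enum.
have : l \in s by rewrite mem_rev mem_enum.
have : descending s := descending_rev_enum.
elim: s => //= i s IH /andP[/allP si ds]; rewrite !inE !big_cons /=.
have [eq_li _|li /= ls] := eqVneq l i.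
  subst i; rewrite -val_eqE ltn_eqF //= => ks; rewrite mulgA E_row_word_pass // -mulgA.
  rewrite row_offdiag_descending // => [|j /si /= jl kj]; last first.
    by rewrite leqNgt jl.
  rewrite -[l == k]val_eqE gtn_eqF //; congr (_ * _).
  apply: eq_bigr => i' _; apply: row_word_eq => j _; congr (if _ then _ + _ else _)%R.
  by case: (leqP l j) => [lj|_]; rewrite ?if_same // (leq_trans kl lj).
have ki : (k < i)%N by apply: ltn_trans kl (si _ ls).
rewrite -val_eqE ltn_eqF //= => ks.
rewrite mulgA (E_row_word_commute _ _ kl ki) 1?eq_sym // -mulgA IH //.
by rewrite -[k == i]val_eqE ltn_eqF.
Qed.

End NormalForm.

(** * Elementary triangular matrices *)

Section ElementaryMatrices.
Variables (n : nat) (S : pzSemiRingType).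
Implicit Types (i j k l : 'I_n) (x y : S) (M : UT n S).
Local Open Scope ring_scope.

Lemma UT_entry0 M i j : (j < i)%N -> M i j = 0.
Proof. by move=> ji; have /is_trig_mxP/(_ j i ji) := UTvalP M; rewrite mxE. Qed.

Lemma UT1E i j : (1%g : UT n S) i j = (i == j)%:R.
Proof. by rewrite mxE. Qed.

Lemma diag_subproof k x : is_trig_mx
  (\matrix_(i < n, j < n) (if i == j then if i == k then x else 1 else 0))^T.
Proof.
by apply/is_trig_mxP => i j ij; rewrite !mxE -val_eqE gtn_eqF.
Qed.
Definition diag_UT k x : UT n S := MkUT (diag_subproof k x).

Lemma elem_subproof k l x : is_trig_mx
  (\matrix_(i < n, j < n) ((i == j)%:R + x *+ [&& i == k, j == l & k < l]%N))^T.
Proof.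
apply/is_trig_mxP => i j ij; rewrite !mxE -val_eqE gtn_eqF // add0r.
case: and3P => // -[/eqP jk /eqP il]; move: ij.
by rewrite jk il ltnNge => + /ltnW => /negbTE->.
Qed.
(** The junk value for [l <= k] is the identity. *)
Definition elem_UT k l x : UT n S := MkUT (elem_subproof k l x).

Lemma diag_UTE k x M i j :
  (diag_UT k x * M)%g i j = if i == k then x * M i j else M i j.
Proof.
rewrite mxE (bigD1 i) //= mxE eqxx big1 => [|m mi].
  by rewrite addr0; case: ifP => // _; rewrite mul1r.
by rewrite mxE eq_sym (negbTE mi) mul0r.
Qed.

Lemma elem_UTE k l x M i j : (k < l)%N ->
  (elem_UT k l x * M)%g i j = if i == k then M i j + x * M l j else M i j.
Proof.
move=> kl; rewrite mxE.
under eq_bigr => m _ do rewrite mxE mulrDl kl andbT.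
rewrite big_split /= (bigD1 i) //= eqxx mul1r big1 => [|m mi]; last first.
  by rewrite eq_sym (negbTE mi) mul0r.
rewrite addr0; case: eqP => [ik|_]; last first.
  by rewrite big1 ?addr0 // => m _; rewrite mul0r.
rewrite (bigD1 l) //= eqxx mulr1n big1 ?addr0 // => m ml.
by rewrite (negbTE ml) mul0r.
Qed.

(** With this, identities between elementary matrices are checked on their
    action by row operations rather than on products of entries. *)
Lemma UT_eqP M M' : (forall N i j, (M * N)%g i j = (M' * N)%g i j) -> M = M'.
Proof.
by move=> MM'; apply/val_inj/matrixP => i j; have := MM' 1%g i j; rewrite !mulg1.
Qed.

Lemma elementary_relations_UT : elementary_relations diag_UT elem_UT.
Proof.
split.
- by move=> i; apply: UT_eqP => M p q; rewrite diag_UTE mul1g mul1r if_same.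
- move=> i x y; apply: UT_eqP => M p q; rewrite -mulgA !diag_UTE.
  by case: eqP => // _; rewrite mulrA.
- move=> i j ij; apply: UT_eqP => M p q; rewrite elem_UTE // mul1g.
  by rewrite mul0r addr0 if_same.
- move=> i j x y ij; apply: UT_eqP => M p q; rewrite -mulgA !elem_UTE //.
  have [ji|_] := eqVneq j i; first by rewrite ji ltnn in ij.
  by case: eqP => // _; rewrite mulrDl -addrA [x * _ + _]addrC.
- move=> i j x y ij; apply: UT_eqP => M p q; rewrite -!mulgA !diag_UTE.
  by have [->|//] := eqVneq p i; rewrite (negbTE ij).
- move=> k i j x y ij ki kj; apply: UT_eqP => M p q.
  rewrite -!mulgA !(diag_UTE, elem_UTE) // [j == k]eq_sym (negbTE kj).
  by have [->|//] := eqVneq p k; rewrite (negbTE ki).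
- move=> i j x y ij; apply: UT_eqP => M p q.
  rewrite -!mulgA !(diag_UTE, elem_UTE) //.
  have [ji|_] := eqVneq j i; first by rewrite ji ltnn in ij.
  by case: eqP => // _; rewrite mulrDr mulrA.
- move=> i j x y ij; apply: UT_eqP => M p q.
  rewrite -!mulgA !(diag_UTE, elem_UTE) // eqxx.
  have [->|//] := eqVneq p i; have [ij'|_] := eqVneq i j.
    by rewrite ij' ltnn in ij.
  by rewrite mulrA.
- move=> i j s t x y ij st js ti; apply: UT_eqP => M p q.
  rewrite -!mulgA !elem_UTE // (negbTE js) (negbTE ti).
  case: (p =P i) => _; case: (p =P s) => // _.
  by rewrite -!addrA [x * _ + _]addrC.
- move=> i j t x y ij jt; apply: UT_eqP => M p q.
  have it := ltn_trans ij jt; rewrite -!mulgA !elem_UTE // eqxx.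
  have [ti|_] := eqVneq t i; first by rewrite ti ltnn in it.
  have [ji|_] := eqVneq j i; first by rewrite ji ltnn in ij.
  have [->|//] := eqVneq p i.
  have [ij'|_] := eqVneq i j; first by rewrite ij' ltnn in ij.
  by rewrite mulrDr -!mulrA -!addrA [x * _ + _]addrC.
Qed.

Lemma row_offdiag_UTE k (r : 'I_n -> S) N i j :
  (row_offdiag elem_UT k r * N)%g i j
  = if i == k then N i j + \sum_(l < n | (k < l)%N) r l * N l j else N i j.
Proof.
rewrite /row_offdiag; elim: (index_enum _) i => [|l s IH] i.
  by rewrite !big_nil mul1g addr0 if_same.
rewrite !big_cons; case: ifP => // kl; rewrite -mulgA elem_UTE // !IH.
rewrite -[l == k]val_eqE gtn_eqF //.
by case: eqP => // _; rewrite -addrA [_ + r l * _]addrC.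
Qed.

Lemma normal_word_UT M : normal_word diag_UT elem_UT (fun i j => M i j) = M.
Proof.
apply/val_inj/matrixP => p q.
(* After the rows in a descending list [s] have been inserted, the rows outside
   [s] are still those of the identity. *)
have suffix s p' q' : descending s ->
    (\prod_(i <- s) row_word diag_UT elem_UT i (fun j => M i j))%g p' q'
    = if p' \in s then M p' q' else (p' == q')%:R.
  elim: s p' q' => [|i s IH] p' q' /=; first by rewrite big_nil UT1E.
  case/andP=> /allP si ds; rewrite big_cons /row_word -!mulgA row_offdiag_UTE.
  rewrite inE diag_UTE; have [->|p'i] := eqVneq p' i; last by rewrite IH.
  have i's j : (i <= j)%N -> (j \in s) = false.
    by move=> ij; apply/negbTE/negP => /si; rewrite ltnNge ij.
  rewrite IH // i's //=.
  transitivity (\sum_(l < n | (i <= l)%N) M i l * (l == q')%:R).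
    rewrite [RHS](bigD1 i) //=; congr (_ + _); apply: eq_big => [l|l il].
      by rewrite ltn_neqAle andbC eq_sym.
    by rewrite diag_UTE IH // i's 1?ltnW // -[l == i]val_eqE gtn_eqF.
  case: (leqP i q') => [iq|qi].
    rewrite (bigD1 q') //= eqxx mulr1 big1 ?addr0 // => l /andP[_ /negbTE->].
    by rewrite mulr0.
  rewrite UT_entry0 // big1 // => l il.
  by rewrite -val_eqE gtn_eqF ?mulr0 // (leq_trans qi).
by rewrite suffix ?mem_rev ?mem_enum //; apply: descending_rev_enum.
Qed.

Lemma UT_ind (Q : UT n S -> Prop) : Q 1%g -> (forall A B, Q A -> Q B -> Q (A * B)%g) ->
  (forall k x, Q (diag_UT k x)) -> (forall k l x, (k < l)%N -> Q (elem_UT k l x)) ->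
  forall M, Q M.
Proof.
move=> Q1 QM QD QE M; rewrite -[M]normal_word_UT.
apply: big_ind => // i _; apply: (QM) => //.
by apply: big_ind => // j ij; apply: QE.
Qed.

End ElementaryMatrices.

Section NormalFormAction.
Variables (n : nat) (S : pzSemiRingType) (P : monoidType).
Variables (D : 'I_n -> S -> P) (E : 'I_n -> 'I_n -> S -> P).
Hypothesis DE : elementary_relations D E.

Definition normal_form (M : UT n S) : P := normal_word D E (fun i j => M i j).

Lemma normal_form1 : normal_form 1 = 1.
Proof.
by rewrite -(normal_word1 DE); apply: normal_word_eq => i j _; rewrite UT1E.
Qed.

Lemma D_normal_form k x M : D k x * normal_form M = normal_form (diag_UT k x * M).
Proof.
rewrite /normal_form (D_normal_word DE); apply: normal_word_eq => i j _.
by rewrite diag_UTE; case: eqP => // ->.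
Qed.

Lemma E_normal_form (k l : 'I_n) x M : (k < l)%N ->
  E k l x * normal_form M = normal_form (elem_UT k l x * M).
Proof.
move=> kl; rewrite /normal_form (E_normal_word DE) //; apply: normal_word_eq => i j _.
rewrite elem_UTE //; case: eqP => // ->.
by case: (leqP l j) => // jl; rewrite [M l j]UT_entry0 // mulr0.
Qed.

End NormalFormAction.

(** * Units and commuting products in monoids *)

Section Units.
Variable P : monoidType.
Implicit Types (u v w z : P) (x y : int).

(** Units are handled with an explicit inverse, the ambient type being only a
    monoid. *)
Definition inverses u v := u * v = 1 /\ v * u = 1.

Lemma inverses_unique u v w : inverses u v -> u * w = 1 -> w = v.
Proof. by case=> _ vu uw; rewrite -[w]mul1g -vu -mulgA uw mulg1. Qed.

Lemma commute_inverse u v z : inverses u v -> commute z u -> commute z v.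
Proof.
case=> uv vu zu; rewrite /commute -[z * v]mul1g -vu.
by rewrite -mulgA (mulgA u) -zu -(mulgA z) uv mulg1.
Qed.

Definition zpow u v x : P :=
  match x with Posz m => u ^+ m | Negz m => v ^+ m.+1 end.

Lemma commute_zpow u v z x : inverses u v -> commute z u -> commute z (zpow u v x).
Proof.
move=> uv zu; have zv := commute_inverse uv zu.
by case: x => m; apply: commuteX.
Qed.

Lemma zpowMC u v u' v' x : commute u u' -> commute v v' ->
  zpow (u * u') (v * v') x = zpow u v x * zpow u' v' x.
Proof. by move=> uu' vv'; case: x => m; apply: expgMn. Qed.

Lemma inversesM u v u' v' : commute u u' -> inverses u v -> inverses u' v' ->
  inverses (u * u') (v * v').
Proof.
move=> uu' [uv vu] [uv' vu']; split.
  by rewrite uu' -mulgA (mulgA u) uv mul1g.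
by rewrite uu' -mulgA (mulgA v') vu' mul1g.
Qed.

Lemma zpowS u v x : inverses u v -> zpow u v (1 + x)%R = u * zpow u v x.
Proof.
case=> uv vu; case: x => [m|[|m]]; first exact: expgS.
  by rewrite /= expg1 uv.
have -> : (1 + Negz m.+1)%R = Negz m.
  by rewrite !NegzE -[in LHS]addn1 PoszD opprD addrCA subrr addr0.
by rewrite [zpow u v (Negz m.+1)]/= expgS mulgA uv mul1g.
Qed.

Lemma zpowD u v x y : inverses u v -> zpow u v (x + y)%R = zpow u v x * zpow u v y.
Proof.
move=> uv; elim/int_rec: x => [|m IH|m IH]; first by rewrite add0r mul1g.
- by rewrite intS -addrA !zpowS // IH mulgA.
have [_ vu] := uv.
rewrite -[LHS]mul1g -[in RHS](mul1g (zpow _ _ _)) -vu -!mulgA (mulgA u) -!zpowS //.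
by rewrite addrA intS opprD addrA subrr add0r IH.
Qed.

Lemma zpowNr u v x : inverses u v -> inverses (zpow u v x) (zpow u v (- x)).
Proof. by move=> uv; split; rewrite -zpowD // ?subrr ?addNr. Qed.

Lemma intertwineM t u u' v v' : u * t = t * u' -> v * t = t * v' ->
  u * v * t = t * (u' * v').
Proof. by move=> ut vt; rewrite -mulgA vt mulgA ut mulgA. Qed.

End Units.

Section CommutingProducts.
Variables (P : monoidType) (I : eqType) (F : I -> P).
Hypothesis FC : forall i j, commute (F i) (F j).

Lemma prod_rem i s : i \in s -> \prod_(j <- s) F j = F i * \prod_(j <- rem i s) F j.
Proof.
elim: s => //= j s IH; rewrite inE big_cons eq_sym.
have [-> //|_ /= si] := eqVneq j i.
by rewrite IH // big_cons !mulgA (FC j).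
Qed.

(** Used to see that [a_i a_j] commutes with [d_ij]: the product of all [a_k]
    does, and so does every [a_k] with [k] different from [i] and [j]. *)
Lemma commute_prod_cancel z d s :
    (forall i, i \in s -> commute d (F i)) -> (forall i, exists v, v * F i = 1) ->
  commute d (\prod_(i <- s) F i * z) -> commute d z.
Proof.
move=> + Fl; elim: s => [|i s IH] ds; first by rewrite big_nil mul1g.
rewrite big_cons -mulgA => dsz.
apply: IH => [j js|]; first by apply: ds; rewrite inE js orbT.
have [v vF] := Fl i; have := congr1 (fun y => v * y) dsz.
rewrite /= (mulgA d) ds ?mem_head // -!mulgA !(mulgA v) vF !mul1g /commute => ->.
by rewrite mulgA.
Qed.

End CommutingProducts.

(** * From the letters to the elementary relations *)

Section TropicalRelations.
Variables (n : nat) (P : monoidType) (g : letter n -> P).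

Definition eval (w : seq (letter n)) : P := \prod_(x <- w) g x.

Lemma eval_nil : eval [::] = 1. Proof. exact: big_nil. Qed.

Lemma eval_seq1 x : eval [:: x] = g x. Proof. exact: big_seq1. Qed.

Lemma eval_cons x w : eval (x :: w) = g x * eval w. Proof. exact: big_cons. Qed.

Lemma eval_cat u v : eval (u ++ v) = eval u * eval v.
Proof. exact: big_cat. Qed.

Hypothesis gR : forall u v, relations (u, v) -> eval u = eval v.

Let a k := g (La k).
Let b := g Lb.
Let c k := g (Lc k).

(** A total version of the letters [d_ij], free of the proof of [i < j]. *)
Definition elem_letter (i j : 'I_n) : P :=
  match @idP (i < j)%N with ReflectT ij => g (Ld ij) | ReflectF _ => 1 end.
Local Notation d := elem_letter.

Lemma elem_letterE (i j : 'I_n) (ij : (i < j)%N) : g (Ld ij) = d i j.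
Proof.
rewrite /d; case: {-}_ / idP => [ij'|//].
by congr (g _); rewrite (bool_irrelevance ij ij').
Qed.

Let rel2 x y z t : relations ([:: x; y], [:: z; t]) -> g x * g y = g z * g t.
Proof. by move/gR; rewrite /eval !big_cons !big_nil !mulg1. Qed.

Let aC i j : commute (a i) (a j).
Proof.
have aC' (p q : 'I_n) : (p < q)%N -> commute (a p) (a q).
  by move=> pq; apply/rel2/rel_C1.
case: (ltngtP i j) => [/aC' //|/aC'/commute_sym //|/val_inj->]; exact: commute_refl.
Qed.

Let cC i j : commute (c i) (c j).
Proof.
have cC' (p q : 'I_n) : (p < q)%N -> commute (c p) (c q).
  by move=> pq; apply/rel2/rel_C2.
case: (ltngtP i j) => [/cC' //|/cC'/commute_sym //|/val_inj->]; exact: commute_refl.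
Qed.

Let prod_ab : (\prod_(k <- enum 'I_n) a k) * b = 1.
Proof.
by have := gR (rel_R3 n); rewrite /eval big_cat big_map big_seq1 big_nil.
Qed.

Let ab k : commute (a k) b. Proof. exact/rel2/rel_R1. Qed.

(** By [rel_R3], [b] and the [a_l] with [l != k] together invert [a_k]. *)
Definition a_inv k : P := \prod_(l <- rem k (enum 'I_n)) a l * b.

Lemma a_invP k : inverses (a k) (a_inv k).
Proof.
have ak : a k * a_inv k = 1.
  by rewrite /a_inv mulgA -(prod_rem aC) ?mem_enum ?prod_ab.
split=> //; rewrite -ak; apply/commute_sym/commuteM => //.
exact: commute_prod.
Qed.

Definition torus k (x : int) : P := zpow (a k) (a_inv k) x.

Let commute_torus z k x : commute z (a k) -> commute z (torus k x).
Proof. exact: commute_zpow (a_invP k). Qed.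

Let torusC i j x y : commute (torus i x) (torus j y).
Proof.
by apply/commute_torus/commute_sym/commute_torus.
Qed.

Let torusD i x y : torus i (x + y)%R = torus i x * torus i y.
Proof. exact: zpowD (a_invP i). Qed.

Let torusN i x : inverses (torus i x) (torus i (- x)).
Proof. exact: zpowNr (a_invP i). Qed.

Let torus0 i : torus i 0 = 1. Proof. by []. Qed.

Let torus_c i k x : commute (torus i x) (c k).
Proof. by apply/commute_sym/commute_torus/commute_sym/rel2/rel_C5. Qed.

Let torus_c_absorb k x : torus k x * c k = c k.
Proof.
have ac : a k * c k = c k.
  by have := gR (rel_Z1 k); rewrite /eval !big_cons !big_nil !mulg1.
have absorb m : torus k (Posz m) * c k = c k.
  by elim: m => [|m IH]; rewrite ?mul1g // /torus /= expgS -mulgA IH.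
case: x => m //; rewrite -{1}(absorb m.+1) mulgA NegzE.
by rewrite -torusD addNr mul1g.
Qed.

Let torus_d (k i j : 'I_n) x : (i < j)%N -> k != i -> k != j ->
  commute (torus k x) (d i j).
Proof.
move=> ij ki kj; apply/commute_sym/commute_torus/commute_sym.
by rewrite -(elem_letterE ij); apply/rel2/rel_C6.
Qed.

Let bd (i j : 'I_n) : (i < j)%N -> commute (d i j) b.
Proof. by move=> ij; rewrite -(elem_letterE ij); apply/rel2/rel_R2. Qed.

(** As [d_ij] commutes with [b], it commutes with the inverse of [b], which is
    the product of all [a_k]; by [rel_C6] only [a_i a_j] matters there.  Hence
    conjugation of [d_ij] by [a_j] is the inverse of conjugation by [a_i]. *)
Let torus_pair_d (i j : 'I_n) x : (i < j)%N -> commute (torus i x * torus j x) (d i j).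
Proof.
move=> ij; have ji : j != i by rewrite -val_eqE gtn_eqF.
rewrite -zpowMC //; last first.
  apply/commute_inverse; first exact: a_invP.
  by apply/commute_sym/commute_inverse; first exact: a_invP.
apply/commute_sym/commute_zpow; first exact: inversesM (a_invP i) (a_invP j).
have abI : inverses b (\prod_(k <- enum 'I_n) a k).
  by split=> //; rewrite -[RHS]prod_ab; apply: commute_prod => k _; apply: commute_sym.
apply: (@commute_prod_cancel _ _ a _ _ (rem j (rem i (enum 'I_n)))) => [k|k|].
- rewrite mem_rem_uniq ?rem_uniq ?enum_uniq // inE => /andP[kj].
  rewrite mem_rem_uniq ?enum_uniq // inE => /andP[ki _].
  by rewrite -(elem_letterE ij); apply/commute_sym/rel2/rel_C6.
- by exists (a_inv k); case: (a_invP k).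
suff -> : \prod_(k <- rem j (rem i (enum 'I_n))) a k * (a i * a j)
    = \prod_(k <- enum 'I_n) a k by apply: commute_inverse abI _; apply: bd.
rewrite (@prod_rem _ _ a aC i (enum _)) ?mem_enum //.
rewrite (@prod_rem _ _ a aC j (rem i (enum 'I_n))); last first.
  by rewrite mem_rem_uniq ?enum_uniq // inE ji mem_enum.
rewrite [RHS]mulgA; apply: commute_sym; apply: commute_prod => k _.
by apply/commute_sym/commuteM.
Qed.

(** In matrices this is [E i j x], the entry [0] of [d_ij] being rescaled by
    the row operation [a_i ^ x]. *)
Definition conj_elem i j (x : int) : P := torus i x * d i j * torus i (- x).
Local Notation e := conj_elem.

Let e0 i j : e i j 0 = d i j. Proof. by rewrite /e oppr0 !torus0 mul1g mulg1. Qed.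

Let e_row (i j : 'I_n) x y : (i < j)%N ->
  torus i y * e i j x = e i j (x + y)%R * torus i y.
Proof.
move=> ij; rewrite /e -!mulgA -torusD opprD subrK !mulgA -torusD.
by rewrite [(y + x)%R]addrC.
Qed.

Let e_col (i j : 'I_n) x y : (i < j)%N ->
  torus j y * e i j x = e i j (x - y)%R * torus j y.
Proof.
move=> ij; have [_ iNy] := torusN i y.
have dj : torus j y * d i j = torus i (- y) * d i j * torus i y * torus j y.
  rewrite -[LHS]mul1g -iNy -!mulgA; congr (_ * _).
  by rewrite [LHS]mulgA torus_pair_d.
rewrite /e !mulgA torusC -(mulgA (torus i x)) dj !mulgA -torusD -!mulgA.
by rewrite torusC opprB (mulgA (torus i y)) -torusD.
Qed.

Let e_other (k i j : 'I_n) x y : (i < j)%N -> k != i -> k != j ->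
  commute (torus k y) (e i j x).
Proof.
by move=> ij ki kj; do 2!apply: commuteM => //; apply: torus_d.
Qed.

Let torus_cancel k x : injective (fun u => u * torus k x).
Proof.
move=> u v uv; have [kx _] := torusN k x.
by rewrite -[u]mulg1 -[v]mulg1 -kx !mulgA uv.
Qed.

Let e_conj_row (i j : 'I_n) x : (i < j)%N -> e i j x * torus i x = torus i x * d i j.
Proof. by move=> ij; rewrite -e0 e_row // add0r. Qed.

Let e_conj_col (i j : 'I_n) x : (i < j)%N ->
  e i j x * torus j (- x) = torus j (- x) * d i j.
Proof. by move=> ij; rewrite -e0 e_col // opprK add0r. Qed.

Let torus2_cancel i x j y : injective (fun u : P => u * (torus i x * torus j y)).
Proof. by move=> u v /=; rewrite !mulgA => /torus_cancel/torus_cancel. Qed.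

(** The relation [rel_C10] says that [e i j 1] absorbs [d_ij] on its left, and [rel_C11]
    that [d_ij] absorbs [e i j (-1)] on its right; conjugation by a power of
    [a_i] moves the two exponents to [x] and [x + 1]. *)
Let e_absorb1 (i j : 'I_n) x : (i < j)%N ->
  e i j x * e i j (x + 1)%R = e i j (x + 1)%R
  /\ e i j (x + 1)%R * e i j x = e i j (x + 1)%R.
Proof.
move=> ij.
have shift y z : e i j (y + z)%R * torus i z = torus i z * e i j y by rewrite e_row.
split.
  apply: (@torus_cancel i x).
  rewrite -mulgA [(x + 1)%R]addrC shift (mulgA (e i j x)) e_conj_row //.
  rewrite -(mulgA (torus i x)); congr (_ * _).
  apply: (@torus_cancel i 1%R); rewrite -mulgA e_conj_row // mulgA -(elem_letterE ij).
  by have := gR (rel_C10 ij); rewrite /eval !big_cons !big_nil !mulg1 mulgA.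
apply: (@torus_cancel i (x + 1)%R).
have -> : e i j x = e i j (-1 + (x + 1))%R by rewrite addrCA addNr addr0.
rewrite -mulgA shift (mulgA (e i j _)) e_conj_row // -(mulgA (torus i _)); congr (_ * _).
apply: (@torus_cancel j 1%R).
rewrite -mulgA -[(- 1)%R]add0r -e_col // e0 mulgA -(elem_letterE ij).
by have := gR (rel_C11 ij); rewrite /eval !big_cons !big_nil !mulg1 mulgA.
Qed.

Let e_absorb (i j : 'I_n) x y : (i < j)%N -> (x <= y)%R ->
  e i j x * e i j y = e i j y /\ e i j y * e i j x = e i j y.
Proof.
move=> ij xy; have /eqP : `|y - x|%R = (y - x)%R by rewrite ger0_norm ?subr_ge0.
rewrite -abszE eq_sym subr_eq => /eqP ->; elim: `|_|%N => [|m [IHl IHr]].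
  have := gR (rel_C4 ij); rewrite /eval !big_cons !big_nil !mulg1 (elem_letterE ij) => dd.
  rewrite add0r; suff: e i j x * e i j x = e i j x by [].
  apply: (@torus_cancel i x); rewrite -mulgA -[x in e i j x]add0r -e_row // mulgA.
  by rewrite -e_row // -mulgA e0 dd.
have [l r] := e_absorb1 (m%:Z + x) ij; rewrite intS -addrA addrC.
split; first by rewrite -{1}l mulgA IHl l.
by rewrite -{1}r -mulgA IHr r.
Qed.

(** If [(i, j)] and [(s, t)] differ, a product of two powers of letters [a_k]
    conjugates [d_ij] and [d_st] to the two elements at once, and [rel_C8] applies.
    If they are equal no such product exists when [x] and [y] differ, but then
    one element absorbs the other. *)
Let e_commute (i j s t : 'I_n) x y : (i < j)%N -> (s < t)%N -> j != s -> t != i ->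
  commute (e i j x) (e s t y).
Proof.
move=> ij st js ti; have nji : j != i by rewrite -val_eqE gtn_eqF.
have nts : t != s by rewrite -val_eqE gtn_eqF.
have dC : commute (d i j) (d s t).
  by rewrite -(elem_letterE ij) -(elem_letterE st); apply/rel2/rel_C8.
have [is_|nis] := eqVneq i s; first (subst s; have [jt|njt] := eqVneq j t).
- subst t; rewrite /commute.
  by case: (leP x y) => [|/ltW] /(e_absorb ij)[-> ->].
- have xT : e i j x * (torus j (- x) * torus t (- y))
      = torus j (- x) * torus t (- y) * d i j.
    by rewrite mulgA e_conj_col // -!mulgA (torus_d _ ij) // eq_sym.
  have yT : e i t y * (torus j (- x) * torus t (- y))
      = torus j (- x) * torus t (- y) * d i t.
    by rewrite mulgA -(e_other _ _ st js njt) -mulgA e_conj_col // mulgA.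
  apply: (@torus2_cancel j (- x)%R t (- y)%R).
  by rewrite (intertwineM xT yT) dC -(intertwineM yT xT).
have xT : e i j x * (torus i x * torus s y) = torus i x * torus s y * d i j.
  by rewrite mulgA e_conj_row // -!mulgA (torus_d _ ij) // eq_sym.
have yT : e s t y * (torus i x * torus s y) = torus i x * torus s y * d s t.
  by rewrite mulgA -(e_other _ _ st nis) 1?eq_sym // -mulgA e_conj_row // mulgA.
by apply: (@torus2_cancel i x s y); rewrite (intertwineM xT yT) dC -(intertwineM yT xT).
Qed.

(** This is [rel_C9] conjugated by [a_i ^ x a_t ^ (- y)], which turns [d_ij], [d_jt]
    and [d_it] into [e i j x], [e j t y] and [e i t (x + y)]. *)
Let e_bracket (i j t : 'I_n) x y : (i < j)%N -> (j < t)%N ->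
  e i j x * e j t y = e j t y * e i j x * e i t (x + y)%R.
Proof.
move=> ij jt; have it := ltn_trans ij jt.
have nij : i != j by rewrite -val_eqE ltn_eqF.
have nit : i != t by rewrite -val_eqE ltn_eqF.
have ntj : t != j by rewrite -val_eqE gtn_eqF.
set T := torus i x * torus t (- y).
have ijT : e i j x * T = T * d i j.
  by rewrite mulgA e_conj_row // -!mulgA (torus_d _ ij) // eq_sym.
have jtT : e j t y * T = T * d j t.
  by rewrite mulgA -(e_other _ _ jt nij nit) -mulgA e_conj_col // mulgA.
have itT : e i t (x + y)%R * T = T * d i t.
  by rewrite mulgA [(x + y)%R]addrC -e_row // -mulgA e_conj_col // mulgA.
apply: (@torus2_cancel i x t (- y)%R); rewrite (intertwineM ijT jtT).
rewrite (intertwineM (intertwineM jtT ijT) itT); congr (_ * _).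
rewrite -(elem_letterE ij) -(elem_letterE jt) -(elem_letterE it).
by have := gR (rel_C9 ij jt it); rewrite /eval !big_cons !big_nil !mulg1 -mulgA.
Qed.

Definition diag_word k (x : Zmax) : P :=
  if x is Some m then torus k m else c k.

Definition elem_word i j (x : Zmax) : P :=
  if x is Some m then e i j m else 1.

Lemma elementary_relations_tropical : elementary_relations diag_word elem_word.
Proof.
split.
- by [].
- move=> i [x|] [y|] /=; rewrite ?torusD ?torus_c_absorb -?torus_c ?torus_c_absorb //.
  by have := gR (rel_C3 i); rewrite /eval !big_cons !big_nil !mulg1.
- by [].
- move=> i j [x|] [y|] ij; rewrite /= ?mul1g ?mulg1 //.
  case: (leP x y) => [xy|/ltW yx]; first by have [] := e_absorb ij xy.
  by have [] := e_absorb ij yx.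
- move=> i j [x|] [y|] ij /=; [exact: torusC | exact: torus_c | | exact: cC].
  exact/commute_sym/torus_c.
- move=> k i j [x|] [y|] ij ki kj /=; try exact: commute1.
    exact: e_other.
  have cd : commute (c k) (d i j).
    by rewrite -(elem_letterE ij); apply/rel2/rel_C7.
  have cT y' : commute (c k) (torus i y') by exact/commute_sym/torus_c.
  by apply: commuteM => //; apply: commuteM.
- move=> i j [x|] [y|] ij /=; rewrite ?mul1g ?mulg1 //.
    by rewrite e_row // addrC.
  rewrite /e !mulgA -torus_c torus_c_absorb.
  have := gR (rel_Z2 ij); rewrite /eval !big_cons !big_nil !mulg1 (elem_letterE ij).
  by rewrite -/(c i) => ->; rewrite -torus_c torus_c_absorb.
- move=> i j [x|] [y|] ij /=; rewrite ?mul1g ?mulg1 //.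
    by rewrite e_col // addrK.
  rewrite /e -!mulgA torus_c (mulgA (d i j)).
  have := gR (rel_Z3 ij); rewrite /eval !big_cons !big_nil !mulg1 (elem_letterE ij).
  rewrite -/(c j) => ->; rewrite -torus_c mulgA.
  by have [-> _] := torusN i y; rewrite mul1g.
- move=> i j s t [x|] [y|] ij st js ti /=;
    [exact: e_commute | exact: commute1 | | exact: commute1].
  exact/commute_sym/commute1.
- move=> i j t [x|] [y|] ij jt /=; rewrite ?mul1g ?mulg1 //.
  exact: e_bracket.
Qed.

End TropicalRelations.

(** * From the elementary relations to the letters *)

(** The letter [b] is kept as a separate parameter: it is determined by [rel_R3] as
    the inverse of the product of the [a_k]. *)
Section LettersFromElementary.
Variables (n : nat) (P : monoidType).
Variables (D : 'I_n -> Zmax -> P) (E : 'I_n -> 'I_n -> Zmax -> P) (b : P).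
Hypothesis DE : elementary_relations D E.
Hypothesis Db : forall k, commute (D k (Some 1%R)) b.
Hypothesis Eb : forall i j : 'I_n, (i < j)%N -> commute (E i j (Some 0%R)) b.
Hypothesis prod_Db : (\prod_(k <- enum 'I_n) D k (Some 1%R)) * b = 1.

Definition letter_of_elementary (x : letter n) : P :=
  match x with
  | La k => D k (Some 1%R)
  | Lb => b
  | Lc k => D k None
  | @Ld _ i j _ => E i j (Some 0%R)
  end.
Local Notation g := letter_of_elementary.

Lemma letter_of_elementary_relations u v : relations (u, v) -> eval g u = eval g v.
Proof.
have DC k x y : commute (D k x) (D k y).
  by rewrite /commute !(er_DM DE) mulrC.
suff main p : relations p -> eval g p.1 = eval g p.2 by exact: (main (u, v)).
rewrite /eval; case=> [i j ij|i j ij|k|i j ij|k l|i j k ij ki kj|i j k ij ki kj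
  |i j s t ij st js ti|i j t ij jt it|i j ij|i j ij|k|i j ij|i j ij|k|i j ij|];
  rewrite ?big_cat /= ?big_map !big_cons !big_nil /= !mulg1.
- by apply: (er_DC DE); rewrite -val_eqE ltn_eqF.
- by apply: (er_DC DE); rewrite -val_eqE ltn_eqF.
- exact: (er_DM DE).
- exact: (er_EA DE).
- by have [->|lk] := eqVneq l k; [exact: DC | exact: (er_DC DE)].
- exact: (er_DEC DE).
- exact: (er_DEC DE).
- exact: (er_EC DE).
- by rewrite (er_EE DE) // mulgA.
- by rewrite (er_DE DE) // mulgA (er_EA DE).
- by rewrite mulgA (er_ED DE) // -mulgA (er_EA DE).
- exact: (er_DM DE).
- by rewrite (er_DE DE) // (er_E0 DE) // mul1g.
- by rewrite (er_ED DE) // (er_E0 DE) // mulg1.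
- exact: Db.
- exact: Eb.
- by rewrite -enumT.
Qed.

Lemma eval_onto_mul u v : (exists w, eval g w = u) -> (exists w, eval g w = v) ->
  exists w, eval g w = u * v.
Proof. by case=> w <- [w' <-]; exists (w ++ w'); rewrite eval_cat. Qed.

Lemma eval_onto_letter x : exists w, eval g w = g x.
Proof. by exists [:: x]; rewrite /eval big_seq1. Qed.

Lemma eval_onto_D k x : exists w, eval g w = D k x.
Proof.
have DX (y : int) m : D k (Some y) ^+ m = D k (Some (y *+ m)%R).
  elim: m => [|m IH]; first by rewrite (er_D1 DE).
  by rewrite expgS IH (er_DM DE) mulrS.
have expP u m : (exists w, eval g w = u) -> exists w, eval g w = u ^+ m.
  move=> imu; elim: m => [|m IH]; first by exists [::]; rewrite /eval big_nil.
  by rewrite expgS; apply: eval_onto_mul.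
case: x => [[m|m]|]; last exact: eval_onto_letter (Lc k).
  by rewrite -[Posz m]natz -DX; apply/expP/(eval_onto_letter (La k)).
rewrite NegzE -natz -mulNrn -DX; apply: expP.
(* The inverse of [a_k] as a word. *)
exists ([seq La l | l <- rem k (enum 'I_n)] ++ [:: Lb]).
rewrite eval_cat /eval big_map big_seq1.
apply/esym/(inverses_unique (a_invP letter_of_elementary_relations k)).
by rewrite (er_DM DE) -(er_D1 DE k).
Qed.

Lemma eval_onto_E (i j : 'I_n) x : (i < j)%N -> exists w, eval g w = E i j x.
Proof.
move=> ij; case: x => [x|]; last by exists [::]; rewrite /eval big_nil (er_E0 DE).
suff -> : E i j (Some x) = D i (Some x) * E i j (Some 0%R) * D i (Some (- x)%R).
  apply: eval_onto_mul (eval_onto_D _ _); apply: eval_onto_mul (eval_onto_D _ _) _.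
  exact: eval_onto_letter (Ld ij).
rewrite (er_DE DE) // -mulgA (er_DM DE).
have -> : ((Some x : Zmax) * (Some (- x)%R : Zmax))%R = 1%R by congr Some; rewrite subrr.
by rewrite (er_D1 DE) mulg1; congr (E _ _ (Some _)); rewrite addr0.
Qed.

End LettersFromElementary.

Section LetterMatrices.
Variable n : nat.
Implicit Types (M : UT n Zmax).

Lemma scalar_subproof (x : Zmax) : is_trig_mx ((x%:M : 'M_n)^T)%R.
Proof. by rewrite tr_scalar_mx scalar_mx_is_trig. Qed.
Definition scalar_UT x : UT n Zmax := MkUT (scalar_subproof x).

Lemma scalar_UTE x M i j : (scalar_UT x * M) i j = (x * M i j)%R.
Proof. by rewrite [LHS](congr1 (fun A : 'M_n => A i j) (mul_scalar_mx _ _)) mxE. Qed.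

Definition letter_UT : letter n -> UT n Zmax := letter_of_elementary
  (@diag_UT n _) (@elem_UT n _) (scalar_UT (Some (- 1)%R)).

Lemma prod_diag_UTE s x M i j : uniq s ->
  (\prod_(k <- s) diag_UT k (x : Zmax) * M) i j
  = if i \in s then (x * M i j)%R else M i j.
Proof.
elim: s i => [|k s IH] i; first by rewrite big_nil mul1g.
rewrite cons_uniq => /andP[ks us]; rewrite big_cons -mulgA diag_UTE inE !IH //.
by have [->|//] := eqVneq i k; rewrite (negbTE ks).
Qed.

Let diag_scalar k x y : commute (diag_UT k x) (scalar_UT y).
Proof.
apply: UT_eqP => M p q; rewrite -!mulgA !(diag_UTE, scalar_UTE).
by case: ifP => // _; rewrite mulrCA.
Qed.

Let elem_scalar (i j : 'I_n) x y : (i < j)%N -> commute (elem_UT i j x) (scalar_UT y).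
Proof.
move=> ij; apply: UT_eqP => M p q; rewrite -!mulgA !(elem_UTE, scalar_UTE) //.
by case: ifP => // _; rewrite mulrDr [in RHS]mulrCA.
Qed.

Let prod_diag_scalar :
  (\prod_(k <- enum 'I_n) diag_UT k (Some 1%R : Zmax)) * scalar_UT (Some (- 1)%R) = 1.
Proof.
apply: UT_eqP => M p q; rewrite -mulgA prod_diag_UTE ?enum_uniq // mem_enum.
by rewrite scalar_UTE mulrA mul1g mul1r.
Qed.

Lemma letter_UT_relations u v :
  relations (u, v) -> eval letter_UT u = eval letter_UT v.
Proof.
exact: (letter_of_elementary_relations (elementary_relations_UT n _)
  (fun k => diag_scalar k _ _) (fun i j => elem_scalar _ _) prod_diag_scalar).
Qed.

Lemma letter_UT_onto M : exists w, eval letter_UT w = M.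
Proof.
apply: (@UT_ind _ _ (fun A => exists w, eval letter_UT w = A)).
- by exists [::]; apply: eval_nil.
- exact: eval_onto_mul.
- exact: (eval_onto_D (elementary_relations_UT n _)
    (fun k => diag_scalar k _ _) (fun i j => elem_scalar _ _) prod_diag_scalar).
- exact: (eval_onto_E (elementary_relations_UT n _)
    (fun k => diag_scalar k _ _) (fun i j => elem_scalar _ _) prod_diag_scalar).
Qed.

End LetterMatrices.

(** * Normal forms of words *)

Section LetterAction.
Variables (n : nat) (P : monoidType) (g : letter n -> P).
Hypothesis gR : forall u v, relations (u, v) -> eval g u = eval g v.

Definition tropical_normal_form := normal_form (diag_word g) (elem_word g).

(** The letters [a_k], [c_k] and [d_ij] are instances of [D] and [E].  For [b], it
    is enough that its inverse, the product of the [a_k], acts as it should. *)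
Lemma letter_normal_form x M :
  g x * tropical_normal_form M = tropical_normal_form (letter_UT x * M).
Proof.
have ER := elementary_relations_tropical gR.
case: x M => [k||k|i j ij] M.
- exact: (D_normal_form ER k (Some 1%R) M).
- have actA s N : eval g [seq La k | k <- s] * tropical_normal_form N
      = tropical_normal_form (eval (@letter_UT n) [seq La k | k <- s] * N).
    elim: s => [|k s IH]; first by rewrite !eval_nil !mul1g.
    by rewrite /= !eval_cons -!mulgA IH; exact: (D_normal_form ER k (Some 1%R)).
  have r3 := rel_R3 n; move: (gR r3) (letter_UT_relations r3).
  set A := [seq La k | k <- _] in r3 *.
  rewrite !eval_cat !eval_seq1 !eval_nil => gAb uAb.
  have bA : g Lb * eval g A = 1.
    rewrite -[RHS]gAb /eval big_map; apply: commute_prod => k _.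
    apply: commute_sym; have := gR (rel_R1 k).
    by rewrite /eval !big_cons !big_nil !mulg1.
  by rewrite -[M in LHS]mul1g -uAb -mulgA -actA mulgA bA mul1g.
- exact: (D_normal_form ER k None M).
- apply: etrans (E_normal_form ER (Some 0%R) M ij); congr (_ * _) => /=.
  by rewrite /conj_elem /torus /= mul1g mulg1 elem_letterE.
Qed.

Lemma eval_normal_form w : tropical_normal_form (eval (@letter_UT n) w) = eval g w.
Proof.
elim: w => [|x w IH]; last by rewrite !eval_cons -IH letter_normal_form.
rewrite !eval_nil; apply: normal_form1 (elementary_relations_tropical gR).
Qed.

End LetterAction.

(** * The presented monoid *)

Section Presentation.
Local Open Scope quotient_scope.
Variables (Sigma : choiceType) (R : set (seq Sigma * seq Sigma)).
Local Notation pi := (\pi_(presented_monoid R)).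

Lemma pi_cat u v : pi (u ++ v) = pi u * pi v :> presented_monoid R.
Proof. exact/esym/pres_mul_pi. Qed.

Lemma pi_relation u v : R (u, v) -> pi u = pi v.
Proof. by move=> uv; apply/eqmodP/asboolP => F [_ RF]; apply: RF. Qed.

Lemma rho_repr_pi w : rho R (repr (pi w), w).
Proof. by have /eqmodP/asboolP := reprK (pi w). Qed.

Lemma rho_morphism (M : monoidType) (f : seq Sigma -> M) u v :
    (forall u v, f (u ++ v) = f u * f v) ->
    (forall u v, R (u, v) -> f u = f v) ->
  rho R (u, v) -> f u = f v.
Proof.
move=> fM fR /(_ (fun p => f p.1 = f p.2)); apply.
split=> [|[u' v'] /fR //]; split=> //=.
- by move=> u1 u2 u3 -> ->.
- by move=> u1 v1 u2 v2; rewrite /= !fM => -> ->.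
Qed.

End Presentation.

Lemma presented_UT n : presented_by (@relations n) (UT n Zmax).
Proof.
pose g (x : letter n) : presented_monoid (@relations n) :=
  (\pi_(presented_monoid (@relations n)) [:: x])%qT.
have eval_g w : eval g w = (\pi_(presented_monoid (@relations n)) w)%qT.
  by elim: w => [|x w IH]; rewrite ?eval_nil // eval_cons IH -pi_cat.
have gR u v : relations (u, v) -> eval g u = eval g v.
  by rewrite !eval_g; apply: pi_relation.
pose phi (x : presented_monoid (@relations n)) := eval (@letter_UT n) (repr x).
have phi_pi w : phi (\pi_(presented_monoid (@relations n)) w)%qT = eval (@letter_UT n) w.
  exact: (rho_morphism (eval_cat _) (@letter_UT_relations n) (rho_repr_pi w)).
have nfK : cancel phi (tropical_normal_form g).
  by move=> x; rewrite /phi eval_normal_form // eval_g reprK.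
exists phi; split.
  split.
    by rewrite -[1]/((\pi_(presented_monoid (@relations n)) [::])%qT) phi_pi eval_nil.
  by move=> x y; rewrite -[x]reprK -[y]reprK -pi_cat !phi_pi eval_cat.
exists (tropical_normal_form g) => // M.
have [w <-] := letter_UT_onto M.
by rewrite eval_normal_form // eval_g phi_pi.
Qed.

(** The longest side of a relation has length 3, or [n + 1] in [rel_R3]. *)
Lemma finite_relations n : finite_set (@relations n : set _).
Proof.
pose m := maxn 3 n.+1.
pose f (p : m.-bseq (letter n) * m.-bseq (letter n)) := (val p.1, val p.2).
apply: (@sub_finite_set _ _ (range f)); last exact/finite_image/finite_finset.
move=> [u v] R.
have [su sv] : size u <= m /\ size v <= m.
  have s3 k : k <= 3 -> k <= m by move=> k3; rewrite leq_max k3.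
  suff main (p : seq (letter n) * seq (letter n)) :
      relations p -> size p.1 <= m /\ size p.2 <= m by exact: main R.
  case=> [i j ij|i j ij|k|i j ij|k l|i j k ij ki kj|i j k ij ki kj
  |i j s t ij st js ti|i j t ij jt it|i j ij|i j ij|k|i j ij|i j ij|k|i j ij|];
  rewrite ?size_cat ?size_map /=; split; try exact: s3.
  by rewrite -enumT size_enum_ord addn1 leq_maxr.
by exists (Bseq su, Bseq sv).
Qed.

Theorem theorem5p4 (n : nat) (n_gt0 : (0 < n)%N) :
  finitely_presented_by (@relations n) (UT n Zmax).
Proof. split; [exact: finite_finset | exact: finite_relations | exact: presented_UT]. Qed.
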